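(* Let $m$ be a non-negative integer. Then $Y^{(m)}(n)$ is nonnegative for all integers $n\geq 0$.
   Context: For a non-negative integer $m$, the integers $Y^{(m)}(n)$ ($n\ge 0$) are defined as the coefficients of the $q$-series (formal power series in $q$, or $|q|<1$) $$\sum_{n\geq0}Y^{(m)}(n)q^{n}:=\sum_{n=1}^{\infty}\frac{(-1)^{n}q^{n(n+1)+2mn}}{1-q^{2n}}-\sum_{n=1}^{\infty}\frac{(-1)^{n}q^{\frac{n(n+1)}{2}+mn}}{1-q^{n}}.$$ *)

(* Defs.v *)
From mathcomp Require Import all_boot all_order all_algebra.
From mathcomp Require Import boolp classical_sets.

Set Implicit Arguments.
Unset Strict Implicit.
Unset Printing Implicit Defensive.

Import Order.TTheory GRing.Theory Num.Theory.
Local Open Scope ring_scope.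

(* f : qseries stands for the formal power series \sum_i (f i) q^i. *)
Definition qseries := nat -> int.

(* q^k *)
Definition qpow (k : nat) : qseries := fun i => (i == k)%:R.

Definition qscale (c : int) (f : qseries) : qseries := fun i => c * f i.

Definition qsub (f g : qseries) : qseries := fun i => f i - g i.

Definition qmul (f g : qseries) : qseries :=
  fun i => \sum_(j < i.+1) f j * g (i - j)%N.

(* The reciprocal of f; the junk value 0 when f is not invertible. *)
Definition qinv (f : qseries) : qseries :=
  xget (fun=> 0) [set g : qseries | qmul f g = qpow 0].

Definition qdiv (f g : qseries) : qseries := qmul f (qinv g).

(* \sum_(n >= n0) F n, for the q-adic topology: the i-th coefficient is the
   value at which the i-th coefficients of the partial sums stabilise (the junk
   value 0 when they do not). *)
Definition qsum_from (n0 : nat) (F : nat -> qseries) : qseries :=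
  fun i => xget 0 [set c : int | exists K0, forall K, (K0 <= K)%N ->
                                   \sum_(n0 <= n < K) F n i = c].

Definition Yseries (m : nat) : qseries :=
  qsub
    (qsum_from 1 (fun n =>
       qdiv (qscale ((-1) ^+ n) (qpow (n * (n + 1) + 2 * m * n)%N))
            (qsub (qpow 0) (qpow (2 * n)%N))))
    (qsum_from 1 (fun n =>
       qdiv (qscale ((-1) ^+ n) (qpow ((n * (n + 1)) %/ 2 + m * n)%N))
            (qsub (qpow 0) (qpow n)))).

Definition Y (m n : nat) : int := Yseries m n.

(* The junk values above are not reached in Yseries: the reciprocals exist and
   the sums converge. *)

Lemma qmul_one_sub_qpow (k : nat) (g : qseries) (i : nat) :
  (0 < k)%N ->
  qmul (qsub (qpow 0) (qpow k)) g i =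
  g i - (if (k <= i)%N then g (i - k)%N else 0).
Proof.
move=> k0; rewrite /qmul /qsub /qpow.
under eq_bigr do rewrite mulrBl.
rewrite sumrB; congr (_ - _).
  rewrite big_ord_recl /= mul1r subn0 big1 ?addr0 // => j _.
  by rewrite /= mul0r.
case: leqP => [ki|ik].
  rewrite (bigD1 (Ordinal (n:=i.+1) (m:=k) ki)) //= eqxx mul1r big1 ?addr0 //.
  move=> j; rewrite -val_eqE /= => /negbTE ->; exact: mul0r.
rewrite big1 // => j _.
have /negbTE -> : (j != k :> nat)%N.
  by apply/eqP => jk; move: (ltn_ord j); rewrite jk ltnS leqNgt ik.
exact: mul0r.
Qed.

Lemma qinv_one_sub_qpow (k : nat) : (0 < k)%N ->
  qinv (qsub (qpow 0) (qpow k)) = fun i => (k %| i)%N%:R.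
Proof.
move=> k0; apply: xget_unique => [/=|g /= Hg].
  apply/funext => i; rewrite qmul_one_sub_qpow // /qpow.
  case: leqP => [ki|ik].
    rewrite dvdn_subl ?ki // subrr.
    by rewrite (gtn_eqF (leq_trans k0 ki)).
  by rewrite subr0; case: i ik => [|i ik]; rewrite ?dvdn0 // gtnNdvd.
apply/funext => i.
have {}Hg j : g j = (j == 0)%N%:R + (if (k <= j)%N then g (j - k)%N else 0).
  by apply/eqP; rewrite -subr_eq -(qmul_one_sub_qpow _ _ k0) Hg.
elim/ltn_ind: i => i IH; rewrite Hg; case: leqP => [ki|ik].
  have i0 := leq_trans k0 ki.
  rewrite IH; last by rewrite ltn_subrL k0.
  by rewrite dvdn_subl // gtn_eqF // add0r.
by rewrite addr0; case: i ik {IH} => [|i ik]; rewrite ?dvdn0 // gtnNdvd.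
Qed.

Lemma qsum_fromE (n0 : nat) (F : nat -> qseries) :
  (forall n i, (i < n)%N -> F n i = 0) ->
  forall i, qsum_from n0 F i = \sum_(n0 <= n < i.+1 + n0) F n i.
Proof.
move=> F0 i.
have stab K : (i.+1 + n0 <= K)%N ->
    \sum_(n0 <= n < K) F n i = \sum_(n0 <= n < i.+1 + n0) F n i.
  move=> leK; rewrite (big_cat_nat (n := i.+1 + n0)) ?leq_addl //=.
  rewrite [X in _ + X]big_nat_cond [X in _ + X]big1 ?addr0 // => n.
  rewrite andbT => /andP[le _]; apply: F0.
  exact: leq_trans (leq_addr _ _) le.
apply: xget_unique => [|c /= [K0 HK]]; first by exists (i.+1 + n0)%N.
rewrite -(HK (maxn K0 (i.+1 + n0))) ?leq_maxl //.
by rewrite stab ?leq_maxr.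
Qed.

Lemma qdiv_one_sub_qpow (c : int) (e k i : nat) : (0 < k)%N ->
  qdiv (qscale c (qpow e)) (qsub (qpow 0) (qpow k)) i =
  c * ((e <= i) && (k %| i - e))%N%:R.
Proof.
move=> k0; rewrite /qdiv qinv_one_sub_qpow // /qmul /qscale /qpow.
case: leqP => [ei|ie] /=.
  rewrite (bigD1 (Ordinal (n:=i.+1) (m:=e) ei)) //= eqxx mulr1 big1 ?addr0 //.
  by move=> j; rewrite -val_eqE /= => /negbTE ->; rewrite mulr0 mul0r.
rewrite big1 ?mulr0 // => j _.
have /negbTE -> : (j != e :> nat)%N.
  by apply/eqP => je; move: (ltn_ord j); rewrite je ltnS leqNgt ie.
by rewrite mulr0 mul0r.
Qed.

Lemma YE (m i : nat) :
  Y m i =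
  \sum_(1 <= n < i.+2) (-1) ^+ n *
    ((n * (n + 1) + 2 * m * n <= i) &&
     (2 * n %| i - (n * (n + 1) + 2 * m * n)))%N%:R
  - \sum_(1 <= n < i.+2) (-1) ^+ n *
    (((n * (n + 1)) %/ 2 + m * n <= i) &&
     (n %| i - ((n * (n + 1)) %/ 2 + m * n)))%N%:R.
Proof.
have trunc (e k : nat -> nat) : (forall n, (0 < n)%N -> (0 < k n)%N) ->
    (forall n, (n <= e n)%N) ->
    qsum_from 1 (fun n => qdiv (qscale ((-1) ^+ n) (qpow (e n)))
                               (qsub (qpow 0) (qpow (k n)))) i
    = \sum_(1 <= n < i.+2)
        (-1) ^+ n * ((e n <= i) && (k n %| i - e n))%N%:R.
  move=> k0 ne; rewrite qsum_fromE => [|n j jn].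
    rewrite addn1 !big_nat; apply: eq_bigr => n /andP[n0 _].
    by rewrite qdiv_one_sub_qpow // k0.
  rewrite qdiv_one_sub_qpow ?k0 ?(leq_ltn_trans _ jn) //.
  by rewrite leqNgt (leq_trans jn (ne n)) mulr0.
rewrite /Y /Yseries {1}/qsub.
rewrite (trunc (fun n => n * (n + 1) + 2 * m * n)%N (fun n => 2 * n)%N).
- rewrite (trunc (fun n => (n * (n + 1)) %/ 2 + m * n)%N id) // => n.
  rewrite (leq_trans _ (leq_addr _ _)) // leq_divRL //.
  by case: n => // n; rewrite leq_mul2l addn1.
- by move=> n n0; rewrite muln_gt0.
- by move=> n; rewrite (leq_trans _ (leq_addr _ _)) // leq_pmulr // addn1.
Qed.

(* Main.v *)
Require Import Defs.
From mathcomp Require Import all_boot all_order all_algebra.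
From mathcomp Require Import zify.

(** Expanding the geometric series in the second sum, its coefficient of [q^N]
    is minus the difference
      #(odd n) - #(even n),
    where [n] ranges over the lengths of the runs of consecutive integers, all
    greater than [m], whose sum is [N].  The first sum is the second one with
    [q] replaced by [q^2].  So if [a N] is that difference, then [Y m N] is
    [a N - a (N / 2)] for even [N], and [a N] for odd [N].

    A run of length [n] whose first and last terms add up to [s] has sum
    [n * s / 2]; the factors [n] and [s] of [2 * N] have opposite parities, and
    the first term exceeds [m] exactly when [n + 2 * m < s].  For
    [N > 0] write [2 * N = t * M] with [M] odd and [t >= 2] a power of two.  The factor [t]
    goes entirely into the even one of [n] and [s], so each run comes from a
    divisor [d] of [M]:
    - odd lengths are [n = d], with [d + 2 * m < t * (M / d)];
    - even lengths are [n = t * d], with [t * d + 2 * m < M / d].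
    The second condition implies the first, hence [a N >= 0].  Replacing [N] by
    [2 * N] keeps [M] and doubles [t]; this weakens the first condition and
    strengthens the second, hence [a (2 * N) >= a N].  These two facts give the
    theorem; the correspondence with divisors is [size_odd_run_lengths] and
    [size_even_run_lengths]. *)

Set Implicit Arguments.
Unset Strict Implicit.
Unset Printing Implicit Defensive.

Import Order.TTheory GRing.Theory Num.Theory.

(** [N] is a sum of [n] consecutive integers, all greater than [m]; the least
    such sum is [n (n + 1) / 2 + m n]. *)
Definition is_run_length (m N n : nat) : bool :=
  ((n * (n + 1)) %/ 2 + m * n <= N) &&
  (n %| N - ((n * (n + 1)) %/ 2 + m * n)).

Lemma double_triangle n : 2 * ((n * (n + 1)) %/ 2) = n * (n + 1).
Proof. by rewrite mulnC divnK // dvdn2 oddM addn1 /= andbN. Qed.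

(** Here [s] is the sum of the first and the last term of the run. *)
Lemma is_run_lengthP m N n : 0 < n ->
  reflect (exists s, [/\ 2 * N = n * s, odd (n + s) & n + 2 * m < s])
          (is_run_length m N n).
Proof.
move=> n0; have T := double_triangle n.
apply: (iffP andP) => [[le /dvdnP[k Ek]]|[s [Es od lt]]].
  by exists (n + 2 * m + 1 + 2 * k); split; [nia | lia | lia].
have [k Ek] : exists k, s = n + 2 * m + 1 + 2 * k.
  by exists ((s - (n + 2 * m + 1)) %/ 2); lia.
have -> : N = (n * (n + 1)) %/ 2 + m * n + k * n by nia.
by rewrite leq_addr addKn dvdn_mull.
Qed.

Lemma is_run_length_leq m N n : 0 < n -> is_run_length m N n -> n <= N.
Proof. by move=> n0 /(is_run_lengthP _ _ n0)[s [E _ lt]]; nia. Qed.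

(** The terms of the series in [q^2] are those of the series in [q], read at
    half the exponent. *)
Lemma run_length_half m i n : 0 < n ->
  (n * (n + 1) + 2 * m * n <= i) && (2 * n %| i - (n * (n + 1) + 2 * m * n))
  = ~~ odd i && is_run_length m i./2 n.
Proof.
move=> n0; have T := double_triangle n; rewrite /is_run_length.
set e := _ + m * n.
have -> : n * (n + 1) + 2 * m * n = 2 * e by rewrite /e -T; lia.
have [oi|ei] /= := boolP (odd i).
  apply/negP => /andP[le /dvdnP[k Ek]].
  have Ei : i = 2 * (e + k * n) by lia.
  by move: oi; rewrite Ei oddM.
have {1 2}-> : i = 2 * i./2 by lia.
by rewrite leq_pmul2l // -mulnBr dvdn_pmul2l.
Qed.

(** Numbers of divisors of the odd part [M] that give runs of odd and of even
    length, when [2 * N = t * M]. *)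
Definition odd_run_count (m t M : nat) : nat :=
  count (fun d => d + 2 * m < t * (M %/ d)) (divisors M).
Definition even_run_count (m t M : nat) : nat :=
  count (fun d => t * d + 2 * m < M %/ d) (divisors M).

(** An odd divisor [n] of [t * M] is prime to the power of two [t], so it
    divides [M], and the cofactor [s] is [t * (M / n)]. *)
Lemma size_odd_run_lengths m N B r M : odd M -> N < B ->
  2 * N = 2 ^ r.+1 * M ->
  size [seq n <- index_iota 1 B | odd n && is_run_length m N n]
  = odd_run_count m (2 ^ r.+1) M.
Proof.
move=> oM NB E; have M0 := odd_gt0 oM; rewrite /odd_run_count -size_filter.
apply: perm_size; apply: uniq_perm; rewrite ?filter_uniq ?iota_uniq //.
  exact: divisors_uniq.
move=> n; rewrite !mem_filter mem_index_iota -dvdn_divisors //.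
apply/andP/andP => [[/andP[on run] /andP[n0 _]]|[lt nM]].
  have [s [Es os ls]] := is_run_lengthP _ _ n0 run.
  have nM : n %| M.
    have cop : coprime n (2 ^ r.+1) by rewrite coprimeXr // coprimen2.
    by rewrite -(Gauss_dvdr _ cop) -E Es dvdn_mulr.
  by rewrite muln_divA // -E Es mulKn.
have n0 : 0 < n by apply: dvdn_gt0 nM.
have on : odd n := dvdn_odd nM oM.
have run : is_run_length m N n.
  apply/(is_run_lengthP _ _ n0); exists (2 ^ r.+1 * (M %/ n)); split=> //.
    by rewrite E mulnCA [n * _]mulnC divnK.
  by rewrite oddD on oddM oddX.
by rewrite on run n0 (leq_ltn_trans (is_run_length_leq n0 run)).
Qed.

(** Here the factor [s] is odd, hence divides [M]; with [d = M / s] the length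
    is [n = t * d]. *)
Lemma size_even_run_lengths m N B r M : odd M -> N < B ->
  2 * N = 2 ^ r.+1 * M ->
  size [seq n <- index_iota 1 B | ~~ odd n && is_run_length m N n]
  = even_run_count m (2 ^ r.+1) M.
Proof.
move=> oM NB E; have M0 := odd_gt0 oM.
have t0 : 0 < 2 ^ r.+1 by rewrite expn_gt0.
have even_t : odd (2 ^ r.+1) = false by rewrite oddX.
rewrite /even_run_count -size_filter -[RHS](size_map (muln (2 ^ r.+1))).
apply: perm_size; apply: uniq_perm.
- by rewrite filter_uniq ?iota_uniq.
- rewrite map_inj_uniq ?filter_uniq ?divisors_uniq // => x y /eqP.
  by rewrite eqn_pmul2l // => /eqP.
move=> n; rewrite mem_filter mem_index_iota; apply/andP/mapP.
  move=> [/andP[en run] /andP[n0 _]].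
  have [s [Es os ls]] := is_run_lengthP _ _ n0 run.
  have odd_s : odd s by move: os; rewrite oddD (negbTE en).
  have sM : s %| M.
    have cop : coprime s (2 ^ r.+1) by rewrite coprimeXr // coprimen2.
    by rewrite -(Gauss_dvdr _ cop) -E Es dvdn_mull.
  have s0 := odd_gt0 odd_s.
  have En : n = 2 ^ r.+1 * (M %/ s) by rewrite muln_divA // -E Es mulnK.
  exists (M %/ s) => //; rewrite mem_filter -En -dvdn_divisors // dvdn_div //.
  by rewrite divnA // mulKn // ls.
move=> [d]; rewrite mem_filter -dvdn_divisors // => /andP[lt dM] ->.
have d0 : 0 < d by apply: dvdn_gt0 dM.
have n0 : 0 < 2 ^ r.+1 * d by rewrite muln_gt0 t0.
have run : is_run_length m N (2 ^ r.+1 * d).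
  apply/(is_run_lengthP _ _ n0); exists (M %/ d); split=> //.
    by rewrite E -mulnA [d * _]mulnC divnK.
  by rewrite oddD oddM even_t (dvdn_odd (dvdn_div dM) oM).
rewrite oddM even_t run n0; split=> //.
exact: leq_ltn_trans (is_run_length_leq n0 run) NB.
Qed.

(** Since [1 <= t], moving the factor [t] from the left side to the right side
    of the condition on [d] weakens it. *)
Lemma leq_even_odd_run_count m t M : 0 < t ->
  even_run_count m t M <= odd_run_count m t M.
Proof. by move=> t0; apply: sub_count => d /=; nia. Qed.

Lemma odd_run_count_double m t M :
  odd_run_count m t M <= odd_run_count m (2 * t) M.
Proof. by apply: sub_count => d /=; nia. Qed.

Lemma even_run_count_double m t M :
  even_run_count m (2 * t) M <= even_run_count m t M.
Proof. by apply: sub_count => d /=; nia. Qed.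

Local Open Scope ring_scope.

Lemma alternating_sum_count (P : pred nat) B :
  \sum_(1 <= n < B) (-1) ^+ n * (P n)%:R
  = (size [seq n <- index_iota 1 B | ~~ odd n && P n])%:Z
    - (size [seq n <- index_iota 1 B | odd n && P n])%:Z.
Proof.
elim: (index_iota 1 B) => [|n s IH]; first by rewrite big_nil.
rewrite big_cons IH /= -signr_odd.
by case: (odd n); case: (P n) => /=; lia.
Qed.

Lemma sum_run_lengths m N B r M : odd M -> (N < B)%N ->
  (2 * N = 2 ^ r.+1 * M)%N ->
  \sum_(1 <= n < B) (-1) ^+ n * (is_run_length m N n)%:R
  = (even_run_count m (2 ^ r.+1) M)%:Z - (odd_run_count m (2 ^ r.+1) M)%:Z.
Proof.
move=> oM NB E; rewrite alternating_sum_count.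
by rewrite (size_even_run_lengths m oM NB E) (size_odd_run_lengths m oM NB E).
Qed.

Theorem theorem1p3 (m : nat) (n : nat) : (0 <= Y m n :> int)%R.
Proof.
rewrite YE; set A := (X in X - _); set B := (X in _ - X).
have -> : B = \sum_(1 <= k < n.+2) (-1) ^+ k * (is_run_length m n k)%:R by [].
have {A B} -> :
    A = \sum_(1 <= k < n.+2) (-1) ^+ k * (~~ odd n && is_run_length m n./2 k)%:R.
  rewrite /A !big_nat; apply: eq_bigr => k /andP[k0 _].
  by rewrite run_length_half.
(* For n = 0 there is no odd part, but the two sums coincide. *)
have [->|n_gt0] := posnP n.
  rewrite !big_nat -sumrB big1 // => k /andP[k0 _].
  by rewrite subrr.
have [M oM] := pfactor_coprime (isT : prime 2) n_gt0.
rewrite coprime2n in oM; move: (logn 2 n) => r; rewrite mulnC => En.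
have En2 : (2 * n = 2 ^ r.+1 * M)%N by rewrite En expnS mulnA.
rewrite (sum_run_lengths m oM _ En2) //.
have le_r := leq_even_odd_run_count m M (expn_gt0 2 r.+1).
case: r => [|r] in En En2 le_r *.
  have on : odd n by rewrite En mul1n.
  rewrite big1 => [|k _]; last by rewrite on mulr0.
  lia.
have en : odd n = false by rewrite En oddM oddX.
have Eh : (2 * n./2 = 2 ^ r.+1 * M)%N by lia.
under eq_bigr do rewrite en /=.
rewrite (sum_run_lengths m oM _ Eh); last by lia.
have := odd_run_count_double m (2 ^ r.+1) M.
have := even_run_count_double m (2 ^ r.+1) M.
by rewrite -expnS; lia.
Qed.
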